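(* Let $R$ be a commutative ring, let $T$ be the coframe of Zariski-closed subsets of $\operatorname{Spec}(R)$, and let $D : R \to T$ be the map $D(r) = \{\mathfrak p \in \operatorname{Spec}(R) : r \in \mathfrak p\}$. Then $D$ is a positive, multiplicatively idempotent valuation, and the pair $(T, D)$ is determined up to isomorphism of coframes by the following universal property, which it satisfies: for every coframe $\Gamma$ and every positive, multiplicatively idempotent valuation $\nu : R \to \Gamma$, there exists a unique coframe homomorphism $\hat{\nu} : T \to \Gamma$ such that $\nu = \hat{\nu} \circ D$.
   Context: A coframe is a complete lattice in which finite joins distribute over arbitrary meets. It is regarded as a complete, commutative, additively and multiplicatively idempotent semiring with (arbitrary) addition given by meet, multiplication given by binary join, $0 = \top$ (the greatest element) and $1 = \bot$ (the least element); with the convention $a\le b\iff a+b=a$ the semiring order is the lattice order. A coframe homomorphism preserves arbitrary meets and finite joins (including $\top$ and $\bot$), i.e. it is a homomorphism of complete semirings. The closed subsets of a topological space form a coframe under intersection (meet) and finite union (join), ordered by inclusion. A valuation on a ring $R$ with values in a coframe $\Gamma$ (automatically positive and multiplicatively idempotent, as $\gamma\ge\bot$ and $\gamma\vee\gamma=\gamma$ for all $\gamma$) is a map $\nu:R\to\Gamma$ with $\nu(0)=\top$, $\nu(1)=\nu(-1)=\bot$, $\nu(ab)=\nu(a)\vee\nu(b)$ and $\nu(a+b)\ge\nu(a)\wedge\nu(b)$. *)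

(* Defs.v *)
From HB Require Import structures.
From mathcomp Require Import all_boot all_order all_algebra.
From mathcomp Require Import boolp classical_sets topology_structure.

Set Implicit Arguments.
Unset Strict Implicit.
Unset Printing Implicit Defensive.

Import Order.Theory GRing.Theory.

Local Open Scope classical_set_scope.

(* The supremum of A is the meet of its upper bounds, so arbitrary meets suffice
   for completeness. *)
HB.mixin Record isCoframe d T of Order.TBLattice d T := {
  bigmeet : set T -> T ;
  bigmeetP : forall A : set T, infimums A (bigmeet A) ;
  join_bigmeet : forall (x : T) (A : set T),
    (x `|` bigmeet A)%O = bigmeet [set (x `|` y)%O | y in A]
}.

#[short(type="coframeType")]
HB.structure Definition Coframe d := {T of isCoframe d T & Order.TBLattice d T}.

Definition coframe_morphism d (T : coframeType d) d' (T' : coframeType d')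
    (f : T -> T') : Prop :=
  [/\ forall A : set T, f (bigmeet A) = bigmeet (f @` A),
      Order.join_morphism f,
      f \top%O = \top%O
    & f \bot%O = \bot%O].

Definition coframe_isomorphism d (T : coframeType d) d' (T' : coframeType d')
    (f : T -> T') : Prop :=
  coframe_morphism f /\
  exists g : T' -> T, [/\ coframe_morphism g, cancel f g & cancel g f].

Section ClosedSets.
Variable X : topologicalType.

Local Notation closedX := (@closed X : set (set X)).

Definition closed_sets : Type := {C : set X | C \in closedX}.

HB.instance Definition _ := SubChoice.on closed_sets.

Let closed_setI : meet_closed (mem closedX).
Proof. by move=> A B; rewrite !in_setE; exact: closedI. Qed.

Let closed_setU : join_closed (mem closedX).
Proof. by move=> A B; rewrite !in_setE; exact: closedU. Qed.

Let closed_set0 : \bot%O \in mem closedX.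
Proof. by rewrite in_setE; exact: closed0. Qed.

Let closed_setT : \top%O \in mem closedX.
Proof. by rewrite in_setE; exact: closedT. Qed.

HB.instance Definition _ := Order.SubChoice_isTBSubLattice.Build
  set_display (set X) (mem closedX) set_display closed_sets
  closed_setI closed_setU closed_set0 closed_setT.

Fact closed_bigmeet_subproof (A : set closed_sets) :
  \bigcap_(C in A) val C \in closedX.
Proof. by rewrite in_setE; apply: closed_bigI => C _; exact: set_mem (valP C). Qed.

Definition closed_bigmeet (A : set closed_sets) : closed_sets :=
  SigSub (closed_bigmeet_subproof A).

Let closed_bigmeetP (A : set closed_sets) : infimums A (closed_bigmeet A).
Proof.
split=> [C AC|B lbB].
  by rewrite -Order.le_val; apply/subsetPset => x; exact.
rewrite -Order.le_val; apply/subsetPset => x Bx C AC.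
by have /subsetPset := lbB _ AC; apply.
Qed.

Let closed_join_bigmeet (B : closed_sets) (A : set closed_sets) :
  (B `|` closed_bigmeet A)%O = closed_bigmeet [set (B `|` C)%O | C in A].
Proof.
have valU (C D : closed_sets) : val (C `|` D)%O = val C `|` val D by [].
apply/val_inj; rewrite valU; apply/seteqP; split=> x /=.
  by move=> BAx _ [C AC <-]; rewrite valU; case: BAx => [Bx|Ax];
    [left|right; exact: Ax].
move=> BAx; have [Bx|nBx] := pselect (val B x); [by left|right=> C AC].
have /BAx : [set (B `|` C)%O | C in A] (B `|` C)%O by exists C.
by rewrite valU => -[].
Qed.

HB.instance Definition _ := isCoframe.Build set_display closed_sets
  closed_bigmeetP closed_join_bigmeet.

End ClosedSets.

Local Open Scope ring_scope.

Record prime_ideal (R : comPzRingType) (p : set R) : Prop := PrimeIdeal {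
  prime_ideal0 : p 0 ;
  prime_idealD : forall a b, p a -> p b -> p (a + b) ;
  prime_idealMl : forall a b, p b -> p (a * b) ;
  prime_ideal1 : ~ p 1 ;
  prime_idealM : forall a b, p (a * b) -> p a \/ p b
}.

Record spec (R : comPzRingType) := Spec {
  spec_ideal :> set R ;
  spec_prime : prime_ideal spec_ideal
}.

Definition zero_locus (R : comPzRingType) (S : set R) : set (spec R) :=
  [set p : spec R | S `<=` p].

Section Zariski.
Variable R : comPzRingType.

HB.instance Definition _ := gen_eqMixin (spec R).
HB.instance Definition _ := gen_choiceMixin (spec R).

Definition zariski_open : set (set (spec R)) :=
  [set U | exists S : set R, ~` U = zero_locus S].

Let zariski_openT : zariski_open setT.
Proof.
exists setT; rewrite setCT; apply/seteqP; split=> // p /(_ 1 I).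
exact: prime_ideal1 (spec_prime p).
Qed.

Let zariski_openI : setI_closed zariski_open.
Proof.
move=> U V [S US] [S' VS'].
exists [set r | exists a b, [/\ S a, S' b & r = a * b]].
rewrite setCI US VS'; apply/seteqP; split=> p /=.
  by move=> [pS|pS] _ [a [b [Sa Sb ->]]]; [rewrite mulrC|];
    apply: (prime_idealMl (spec_prime p)); apply: pS.
move=> pSS'; have [|nS] := pselect (S `<=` p); [by left|right=> b Sb].
have /existsNP[a /not_implyP[Sa npa]] := nS.
by have [||//] := prime_idealM (spec_prime p) (pSS' (a * b) _); first by exists a, b.
Qed.

Let zariski_open_bigU (I : Type) (f : I -> set (spec R)) :
  (forall i, zariski_open (f i)) -> zariski_open (\bigcup_i f i).
Proof.
move=> /choice[S fS]; exists (\bigcup_i S i).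
rewrite setC_bigcup; apply/seteqP; split=> p /=.
  move=> pf r [i _ Sr]; have := pf i Logic.I; rewrite fS; exact.
by move=> pS i _; rewrite fS => r Sr; apply: pS; exists i.
Qed.

HB.instance Definition _ :=
  isOpenTopological.Build (spec R) zariski_openT zariski_openI zariski_open_bigU.

Lemma closed_zariski (C : set (spec R)) :
  closed C <-> exists S : set R, C = zero_locus S.
Proof. by rewrite -openC; split=> -[S CS]; exists S; move: CS; rewrite setCK. Qed.

End Zariski.

Fact vanishing_subproof (R : comPzRingType) (r : R) :
  [set p : spec R | spec_ideal p r] \in (@closed (spec R) : set (set (spec R))).
Proof.
apply/mem_set/closed_zariski; exists [set r].
by apply/seteqP; split=> p /= => [pr _ ->//|]; exact.
Qed.

Definition vanishing (R : comPzRingType) (r : R) : closed_sets (spec R) :=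
  SigSub (vanishing_subproof r).

Record valuation (R : comPzRingType) d (G : coframeType d) (nu : R -> G) : Prop :=
  Valuation {
    valuation0 : nu 0 = \top%O ;
    valuation1 : nu 1 = \bot%O ;
    valuationN1 : nu (- 1) = \bot%O ;
    valuationM : forall a b, nu (a * b) = (nu a `|` nu b)%O ;
    valuationD : forall a b, (nu a `&` nu b <= nu (a + b))%O
  }.

(* pmi: positive and multiplicatively idempotent. In the semiring of a coframe
   the unit is \bot, the product is the binary join and the semiring order is the
   lattice order, so the last two conditions always hold. *)
Definition pmi_valuation (R : comPzRingType) d (G : coframeType d)
    (nu : R -> G) : Prop :=
  [/\ valuation nu,
      forall a, (\bot <= nu a)%O
    & forall a, (nu a `|` nu a)%O = nu a].

Definition universal_valuation (R : comPzRingType) d (T : coframeType d)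
    (D : R -> T) : Prop :=
  forall d' (G : coframeType d') (nu : R -> G), pmi_valuation nu ->
    exists! f : T -> G, coframe_morphism f /\ nu = f \o D.

(* Main.v *)
Require Import Defs.
From mathcomp Require Import all_boot all_order all_algebra.
From mathcomp Require Import boolp classical_sets topology_structure.

(* The extension of [nu] sends a closed set [C] to the meet of the [nu r] over
   the [r] vanishing on [C], and this is forced because [C] is itself the meet of
   the corresponding [D r]. It preserves meets because, for every [x] in the
   coframe, [{a | x <= nu a}] is a radical ideal, hence an intersection of primes:
   if [r] vanishes wherever [S] does, then every lower bound of [nu] on [S] is
   below [nu r]. *)

Set Implicit Arguments.
Unset Strict Implicit.
Unset Printing Implicit Defensive.

Import Order.Theory GRing.Theory.

Local Open Scope classical_set_scope.
Local Open Scope ring_scope.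

Section BigMeet.
Context d (T : coframeType d).
Implicit Types (A B : set T) (x : T).

Lemma bigmeet_le A x : A x -> (bigmeet A <= x)%O.
Proof. by have [lbA _] := bigmeetP A; exact: lbA. Qed.

Lemma le_bigmeet A x : (forall y, A y -> (x <= y)%O) -> (x <= bigmeet A)%O.
Proof. by have [_ ubA] := bigmeetP A; exact: ubA. Qed.

(** Coframe distributivity is used twice, once in each argument of the join. *)
Lemma le_join_bigmeet A B x :
  (forall a b, A a -> B b -> (x <= a `|` b)%O) ->
  (x <= bigmeet A `|` bigmeet B)%O.
Proof.
move=> xAB; rewrite join_bigmeet; apply: le_bigmeet => _ [b Bb <-].
rewrite joinC join_bigmeet; apply: le_bigmeet => _ [a Aa <-].
by rewrite joinC; apply: xAB.
Qed.

End BigMeet.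

Section CoframeMorphism.
Context d1 d2 d3 (T1 : coframeType d1) (T2 : coframeType d2)
  (T3 : coframeType d3).

Lemma coframe_morphism_id : coframe_morphism (@id T1).
Proof. by split=> // A; rewrite image_id. Qed.

Lemma coframe_morphism_comp (f : T1 -> T2) (g : T2 -> T3) :
  coframe_morphism f -> coframe_morphism g -> coframe_morphism (g \o f).
Proof.
move=> [fM fU f1 f0] [gM gU g1 g0]; split=> [A|x y||] /=.
- by rewrite fM gM image_comp.
- by rewrite fU gU.
- by rewrite f1 g1.
- by rewrite f0 g0.
Qed.

End CoframeMorphism.

Lemma closed_leP (X : topologicalType) (C D : closed_sets X) :
  (C <= D)%O <-> val C `<=` val D.
Proof. by rewrite -Order.le_val; split=> /subsetPset. Qed.

Lemma val_bigmeet (X : topologicalType) (A : set (closed_sets X)) :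
  val (bigmeet A) = \bigcap_(C in A) val C.
Proof. by []. Qed.

Section RadicalIdeal.
Variable R : comPzRingType.
Implicit Types (I J : set R) (a b r : R).

(** Square roots suffice: if a power of [a] lies in [I], so does some [a ^ (2 ^ k)], and [k] root
    extractions reach [a]. The whole ring is allowed; it occurs as [{a | x <= nu a}] for [x] the
    bottom element. *)
Record radical_ideal I : Prop := RadicalIdeal {
  radical_ideal0 : I 0 ;
  radical_idealD : forall a b, I a -> I b -> I (a + b) ;
  radical_idealMl : forall a b, I b -> I (a * b) ;
  radical_idealX : forall a, I (a * a) -> I a
}.

Lemma radical_ideal_colon I r :
  radical_ideal I -> radical_ideal [set a | I (a * r)].
Proof.
move=> [I0 ID IM IX]; split=> /= [|a b Iar Ibr|a b Ibr|a Iaar].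
- by rewrite mul0r.
- by rewrite mulrDl; apply: ID.
- by rewrite -mulrA; apply: IM.
(* The square of [a * r] is [r] times [a * a * r], which lies in [I]. *)
- by apply: IX; rewrite mulrACA mulrA mulrC; apply: IM.
Qed.

(* Maximality is tested only against the colon ideals [(J : a)] and [(J : r)],
   which are again radical. *)
Lemma maximal_radical_ideal_prime J r :
  radical_ideal J -> ~ J r ->
  (forall K, radical_ideal K -> J `<=` K -> ~ K r -> K `<=` J) ->
  prime_ideal J.
Proof.
move=> rJ nJr maxJ; have [J0 JD JM JX] := rJ.
have colonJ a : ~ J (r * a) -> [set b | J (b * a)] `<=` J.
  move=> nJra; apply: maxJ => //; first exact: radical_ideal_colon.
  by move=> b Jb /=; rewrite mulrC; apply: JM.
split=> // [J1|a b Jab].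
  by apply: nJr; rewrite -[r]mulr1; apply: JM.
(* If [r * b] is outside [J], then [a] lies in [(J : b)], hence in [J]. Otherwise [b] lies in
   [(J : r)], which is inside [J] because [r * r] is not in the radical ideal [J]. *)
have [Jrb|nJrb] := pselect (J (r * b)); last by left; apply: colonJ Jab.
by right; apply: (colonJ r) => /=; [move/JX|rewrite mulrC].
Qed.

(** Zorn's lemma gives a radical ideal maximal among those containing [I] and avoiding [r], and such
    an ideal is prime. *)
Lemma radical_ideal_separation I r :
  radical_ideal I -> ~ I r -> exists p : spec R, I `<=` p /\ ~ spec_ideal p r.
Proof.
move=> rI nIr.
(* The empty set is admitted as the union of the empty chain. *)
pose P J := J !=set0 -> [/\ radical_ideal J, I `<=` J & ~ J r].
have chainP F : F `<=` P -> total_on F subset -> P (\bigcup_(J in F) J).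
  move=> FP totF [c [J0 FJ0 J0c]].
  have FJ J a : F J -> J a -> [/\ radical_ideal J, I `<=` J & ~ J r].
    by move=> /FP + Ja; apply; exists a.
  have [rJ0 IJ0 _] := FJ _ _ FJ0 J0c.
  split=> [|a Ia|[J JF Jr]]; last 2 first.
  - by exists J0 => //; apply: IJ0.
  - by have [_ _] := FJ _ _ JF Jr; apply.
  split=> [|a b [J JF Ja] [K KF Kb]|a b [J JF Jb]|a [J JF Ja]].
  - by exists J0 => //; apply: radical_ideal0.
  - have [JK|KJ] := totF _ _ JF KF.
    + have [rK _ _] := FJ _ _ KF Kb.
      by exists K => //; apply: radical_idealD => //; apply: JK.
    + have [rJ _ _] := FJ _ _ JF Ja.
      by exists J => //; apply: radical_idealD => //; apply: KJ.
  - by have [rJ _ _] := FJ _ _ JF Jb; exists J => //; apply: radical_idealMl.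
  - by have [rJ _ _] := FJ _ _ JF Ja; exists J => //; apply: radical_idealX.
have [J [PJ maxJ]] := Zorn_bigcup chainP.
have J_neq0 : J !=set0.
  (* The empty set is not maximal, since [I] satisfies [P] and contains [0]. *)
  apply/set0P/eqP => J0; apply: (maxJ I); last by move=> _; split.
  by rewrite J0; split=> // /(_ _ (radical_ideal0 rI)).
have [rJ IJ nJr] := PJ J_neq0.
have pJ : prime_ideal J.
  apply: (maximal_radical_ideal_prime rJ nJr) => K rK JK nKr.
  apply: contrapT => nKJ; apply: (maxJ K) => // _.
  by split=> //; apply: subset_trans JK.
by exists (Spec pJ).
Qed.

End RadicalIdeal.

Section Valuation.
Context (R : comPzRingType) d (G : coframeType d) (nu : R -> G).
Hypothesis nuV : valuation nu.

Lemma valuation_pmi : pmi_valuation nu.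
Proof. by split=> // a; rewrite ?le0x ?joinxx. Qed.

Lemma valuation_radical_ideal (x : G) : radical_ideal [set a | (x <= nu a)%O].
Proof.
have [nu0 nu1 _ nuM nuD] := nuV.
split=> /= [|a b xa xb|a b xb|a]; first by rewrite nu0 lex1.
- by apply: le_trans (nuD a b); rewrite lexI xa xb.
- by rewrite nuM lexU2 ?xb ?orbT.
- by rewrite nuM joinxx.
Qed.

Lemma valuation_zero_locus (S : set R) (x : G) (r : R) :
  (forall s, S s -> (x <= nu s)%O) ->
  zero_locus S `<=` val (vanishing r) -> (x <= nu r)%O.
Proof.
move=> xS Sr; apply: contrapT => nxr.
have [p [xp npr]] := radical_ideal_separation (valuation_radical_ideal x) nxr.
by apply: npr; apply: Sr => s /xS; apply: xp.
Qed.

Definition valuation_lift (C : closed_sets (spec R)) : G :=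
  bigmeet [set nu r | r in [set r | (C <= vanishing r)%O]].

Lemma le_valuation_lift C C' :
  (C <= C')%O -> (valuation_lift C <= valuation_lift C')%O.
Proof.
move=> CC'; apply: le_bigmeet => _ [r C'r <-]; apply: bigmeet_le.
by exists r => //; apply: le_trans C'r.
Qed.

Lemma valuation_lift_le C r :
  (C <= vanishing r)%O -> (valuation_lift C <= nu r)%O.
Proof. by move=> Cr; apply: bigmeet_le; exists r. Qed.

(** One inequality holds because [r] is itself an index of the meet. For the other, any [s]
    vanishing wherever [r] does satisfies [nu r <= nu s]. *)
Lemma valuation_lift_vanishing r : valuation_lift (vanishing r) = nu r.
Proof.
apply/eqP; rewrite eq_le valuation_lift_le //=.
apply: le_bigmeet => _ [s /closed_leP rs <-].
apply: (@valuation_zero_locus [set r]) => [_ -> //|p rp].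
by apply: rs; apply: rp.
Qed.

End Valuation.

Section Spectrum.
Variable R : comPzRingType.

Lemma vanishing_valuation : valuation (@vanishing R).
Proof.
split=> [||| a b | a b].
- apply/val_inj/seteqP; split=> // p _.
  exact: prime_ideal0 (spec_prime p).
- by apply/val_inj/seteqP; split=> // p /(prime_ideal1 (spec_prime p)).
- apply/val_inj/seteqP; split=> // p /= pN1.
  apply: (prime_ideal1 (spec_prime p)).
  by have := prime_idealMl (spec_prime p) (- 1) pN1; rewrite mulrNN mulr1.
- apply/val_inj/seteqP; split=> [p /(prime_idealM (spec_prime p))//|p].
  by case=> [pa|pb] /=; [rewrite mulrC|]; apply: prime_idealMl (spec_prime p) _ _ _.
- by apply/closed_leP => p [pa pb]; apply: prime_idealD (spec_prime p) _ _ _ _.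
Qed.

(** If [C] is the zero locus of [S], the indices [s] in [S] alone already cut out [C]. *)
Lemma closed_set_bigmeet_vanishing (C : closed_sets (spec R)) :
  C = bigmeet [set vanishing r | r in [set r | (C <= vanishing r)%O]].
Proof.
apply/eqP; rewrite eq_le; apply/andP; split.
  by apply: le_bigmeet => _ [r Cr <-].
have /set_mem/closed_zariski[S CS] := valP C.
apply/closed_leP; rewrite val_bigmeet CS => p Cp s Ss.
apply: (Cp (vanishing s)); exists s => //=.
by apply/closed_leP; rewrite CS => q; apply.
Qed.

Lemma valuation_lift_morphism d (G : coframeType d) (nu : R -> G) :
  valuation nu -> coframe_morphism (valuation_lift nu).
Proof.
move=> nuV; have [nu0 nu1 _ nuM _] := nuV.
have [v0 v1 _ vM _] := vanishing_valuation.
split=> [A|C C'||].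
- apply/eqP; rewrite eq_le; apply/andP; split.
    apply: le_bigmeet => _ [C AC <-]; apply: le_valuation_lift.
    exact: bigmeet_le.
  apply: le_bigmeet => _ [r /closed_leP Ar <-].
  (* Each member of [A] is cut out by the elements vanishing on it, so the zero locus of [S] lies in
     the intersection of [A]. *)
  pose S := [set s | exists2 C, A C & (C <= vanishing s)%O].
  apply: (@valuation_zero_locus _ _ _ _ nuV S) => [s [C AC Cs]|p Sp].
    by apply: le_trans (valuation_lift_le nu Cs); apply: bigmeet_le; exists C.
  apply: Ar; rewrite val_bigmeet => C AC.
  rewrite (closed_set_bigmeet_vanishing C) val_bigmeet => _ [s Cs <-].
  by apply: Sp; exists C.
- apply/eqP; rewrite eq_le; apply/andP; split.
    (* If [a] vanishes on [C] and [b] on [C'], then [a * b] vanishes on their union. *)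
    apply: le_join_bigmeet => _ _ [a Ca <-] [b C'b <-]; rewrite -nuM.
    by apply: valuation_lift_le; rewrite vM leU2.
  by rewrite leUx !le_valuation_lift ?leUl ?leUr.
- by rewrite -v0 valuation_lift_vanishing.
- by rewrite -v1 valuation_lift_vanishing.
Qed.

Lemma vanishing_universal : universal_valuation (@vanishing R).
Proof.
move=> d G nu [nuV _ _]; exists (valuation_lift nu); split.
  split; first exact: valuation_lift_morphism.
  by apply/funext => r /=; rewrite valuation_lift_vanishing.
move=> f [[fM _ _ _] nuE]; apply/funext => C.
by rewrite {2}(closed_set_bigmeet_vanishing C) fM image_comp /valuation_lift nuE.
Qed.

End Spectrum.

(** Both [h] and the identity factor [D] through itself, so uniqueness identifies them. Applied to
    both composites of the two comparison maps, this makes them mutually inverse. *)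
Lemma universal_valuation_endo (R : comPzRingType) d (T : coframeType d)
    (D : R -> T) (h : T -> T) :
  pmi_valuation D -> universal_valuation D ->
  coframe_morphism h -> D = h \o D -> h = id.
Proof.
move=> Dv /(_ _ _ _ Dv)[f [_ fU]] hm hD.
by rewrite -(fU h) // (fU id) //; split=> //; apply: coframe_morphism_id.
Qed.

Theorem corollary5p13 (R : comPzRingType) :
  [/\ pmi_valuation (@vanishing R),
      universal_valuation (@vanishing R)
    & forall (d : Order.disp_t) (T : coframeType d) (D : R -> T),
        pmi_valuation D -> universal_valuation D ->
        exists2 f : closed_sets (spec R) -> T,
          coframe_isomorphism f & D = f \o @vanishing R].
Proof.
have vV := valuation_pmi (vanishing_valuation R).
have vU := @vanishing_universal R.
split=> // d T D DV DU.
have [f [[fm fD] _]] := vU _ _ _ DV.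
have [g [[gm gD] _]] := DU _ _ _ vV.
have gf : g \o f = id.
  apply: (universal_valuation_endo vV vU); first exact: coframe_morphism_comp.
  by rewrite -compA -fD -gD.
have fg : f \o g = id.
  apply: (universal_valuation_endo DV DU); first exact: coframe_morphism_comp.
  by rewrite -compA -gD -fD.
exists f => //; split=> //; exists g.
by split=> // x; [rewrite -[LHS]/((g \o f) x) gf|rewrite -[LHS]/((f \o g) x) fg].
Qed.
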